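(* Let $A\in\mathbb{M}_n(\mathbb{C})$ be a partial isometry. Then: (i) $A^D$ is a partial isometry if and only if $(A^\dagger)^D=(A^D)^\dagger$; (ii) if $A^D$ is a partial isometry, then (a) $A^{D,\dagger}$ is a partial isometry if and only if $(A^{D,\dagger})^\dagger=(A^\dagger)^{\dagger,D}$; (b) $A^{\dagger,D}$ is a partial isometry if and only if $(A^{\dagger,D})^\dagger=(A^\dagger)^{D,\dagger}$.
   Context: $\mathbb{M}_n(\mathbb{C})$ is the algebra of $n\times n$ complex matrices; $^*$ is conjugate transpose; $B^\dagger$ is the Moore-Penrose inverse of $B$. $B$ is a partial isometry if $B^\dagger=B^*$, equivalently $BB^*B=B$. The index $\mathrm{ind}(B)$ is the smallest integer $k\ge 0$ with $\mathrm{rank}(B^k)=\mathrm{rank}(B^{k+1})$ (with $B^0=I$). With $k=\mathrm{ind}(B)$, the Drazin inverse $B^D$ is the unique $X$ with $BX=XB$, $XBX=X$, $XB^{k+1}=B^k$. For a square matrix $B$, the DMP inverse is $B^{D,\dagger}=B^DBB^\dagger$ and the MPD inverse is $B^{\dagger,D}=B^\dagger BB^D$. *)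

(* Defs.v *)
From mathcomp Require Import all_boot all_order all_algebra.
From mathcomp Require Import spectral.

Set Implicit Arguments.
Unset Strict Implicit.
Unset Printing Implicit Defensive.

Import Order.TTheory GRing.Theory Num.Theory.

Local Open Scope ring_scope.
Local Open Scope sesquilinear_scope.

(* In sesquilinear_scope, M ^t* is the conjugate transpose of M. *)

Section MoorePenrose.
Context {C : numClosedFieldType}.

(* The four Penrose equations. *)
Definition is_mpinv m n (A : 'M[C]_(m, n)) (X : 'M[C]_(n, m)) : bool :=
  [&& A *m X *m A == A, X *m A *m X == X,
      (A *m X) ^t* == A *m X & (X *m A) ^t* == X *m A].

Lemma trmxC_mul m n p (A : 'M[C]_(m, n)) (B : 'M[C]_(n, p)) :
  (A *m B) ^t* = B ^t* *m A ^t*.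
Proof. by rewrite trmx_mul map_mxM. Qed.

Lemma trmxC_eq0 m n (A : 'M[C]_(m, n)) : A *m A ^t* = 0 -> A = 0.
Proof.
move=> AA0; apply/matrixP => i j; rewrite mxE; apply/eqP.
have /eqP := congr1 (fun X : 'M[C]_m => X i i) AA0; rewrite !mxE psumr_eq0.
  by move=> /allP/(_ j (mem_index_enum j)); rewrite !mxE mul_conjC_eq0.
by move=> k _; rewrite !mxE mul_conjC_ge0.
Qed.

Lemma mulmx_trmxC_inj m n p (A : 'M[C]_(m, n)) (B D : 'M[C]_(p, m)) :
  B *m (A *m A ^t*) = D *m (A *m A ^t*) -> B *m A = D *m A.
Proof.
move=> eqBD; apply/eqP; rewrite -subr_eq0 -mulmxBl; apply/eqP/trmxC_eq0.
by rewrite trmxC_mul mulmxA -[_ *m A *m _]mulmxA mulmxBl eqBD subrr mul0mx.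
Qed.

Lemma mulmx_pinvmxK (F : fieldType) m n (M : 'M[F]_(m, n)) :
  M *m pinvmx M *m M = M.
Proof. exact: mulmxKpV. Qed.

Lemma row_projection m n (A : 'M[C]_(m, n)) (G : 'M[C]_m) :
  A *m A ^t* *m G *m (A *m A ^t*) = A *m A ^t* ->
  let P := A ^t* *m G *m A in A *m P = A /\ P ^t* = P.
Proof.
move=> MGM P; have AP : A *m P = A.
  by rewrite /P !mulmxA -[RHS]mul1mx; apply: mulmx_trmxC_inj; rewrite mul1mx.
split=> //; have PP : P ^t* *m P = P ^t*.
  by rewrite {1 3}/P !trmxC_mul trmxCK -!mulmxA AP.
by have := congr1 (fun X : 'M[C]_n => X ^t*) PP; rewrite trmxC_mul !trmxCK PP.
Qed.

Lemma is_mpinv_ex m n (A : 'M[C]_(m, n)) : exists X, is_mpinv A X.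
Proof.
have [G1] : {G | A *m A ^t* *m G *m (A *m A ^t*) = A *m A ^t*}.
  by exists (pinvmx (A *m A ^t*)); exact: mulmx_pinvmxK.
have [G2] : {G | A ^t* *m A *m G *m (A ^t* *m A) = A ^t* *m A}.
  by exists (pinvmx (A ^t* *m A)); exact: mulmx_pinvmxK.
move=> H2 H1; have [AP PH] := row_projection H1.
have := @row_projection _ _ (A ^t*) G2; rewrite trmxCK => /(_ H2)[AQ QH].
set P := _ *m A in AP PH; set Q := _ *m A ^t* in AQ QH.
have QA : Q *m A = A.
  have := congr1 (fun X : 'M[C]_(n, m) => X ^t*) AQ.
  by rewrite trmxC_mul trmxCK QH.
exists (P *m G2 *m A ^t*); set X := P *m G2 *m A ^t*.
have AX : A *m X = Q by rewrite /X 2!mulmxA AP.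
have XQ : X = A ^t* *m G1 *m Q by rewrite /X /P /Q !mulmxA.
have XA : X *m A = P by rewrite XQ -mulmxA QA.
have PP : P *m P = P by rewrite {1}/P -mulmxA AP.
have PX : P *m X = X by rewrite /X 2!mulmxA PP.
by rewrite /is_mpinv AX XA QH PH QA PX !eqxx.
Qed.

(* The Moore-Penrose inverse: the unique solution of the Penrose equations,
   by mpinvP and mpinv_uniq. *)
Definition mpinv m n (A : 'M[C]_(m, n)) : 'M[C]_(n, m) :=
  xchoose (is_mpinv_ex A).

Lemma mpinvP m n (A : 'M[C]_(m, n)) : is_mpinv A (mpinv A).
Proof. exact: xchooseP. Qed.

Lemma is_mpinv_inj m n (A : 'M[C]_(m, n)) (X Y : 'M[C]_(n, m)) :
  is_mpinv A X -> is_mpinv A Y -> X = Y.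
Proof.
move=> /and4P[/eqP AXA /eqP XAX /eqP AXH /eqP XAH].
move=> /and4P[/eqP AYA /eqP YAY /eqP AYH /eqP YAH].
have AXY : A *m X = A *m Y.
  by rewrite -AXH -{1}AYA -mulmxA trmxC_mul AXH AYH mulmxA AXA.
have XYA : X *m A = Y *m A.
  by rewrite -XAH -{1}AYA mulmxA mulmxA -mulmxA trmxC_mul XAH YAH -mulmxA
             [A *m _]mulmxA AXA.
by rewrite -XAX XYA -mulmxA AXY mulmxA YAY.
Qed.

Lemma mpinv_uniq m n (A : 'M[C]_(m, n)) (X : 'M[C]_(n, m)) :
  is_mpinv A X -> mpinv A = X.
Proof. exact/is_mpinv_inj/mpinvP. Qed.

Definition partial_isometry m n (B : 'M[C]_(m, n)) : Prop :=
  mpinv B = B ^t*.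

End MoorePenrose.

Section Drazin.
Context {F : fieldType} {n : nat}.
Implicit Types B X : 'M[F]_n.

Lemma mxindex_ex B : exists k, \rank (B ^+ k) == \rank (B ^+ k.+1).
Proof.
have [m] := ubnP (\rank (B ^+ 0)); elim: m 0%N => // m IHm k rkB.
have [rk_eq | rk_neq] := eqVneq (\rank (B ^+ k)) (\rank (B ^+ k.+1)).
  by exists k; apply/eqP.
rewrite ltnS in rkB; apply: (IHm k.+1); apply: leq_trans rkB.
rewrite ltn_neqAle eq_sym rk_neq /= exprS -mulmxE; exact: mxrankM_maxr.
Qed.

(* ind(B); since 'M[F]_n is a ring, B ^+ 0 is the identity matrix. *)
Definition mxindex B : nat := ex_minn (mxindex_ex B).

Definition is_drazin B X : bool :=
  [&& B *m X == X *m B, X *m B *m X == X &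
      X *m B ^+ (mxindex B).+1 == B ^+ mxindex B].

Lemma is_drazin_ex B : exists X, is_drazin B X.
Proof.
rewrite /is_drazin; set k := mxindex B.
have rk : \rank (B ^+ k) = \rank (B ^+ k.+1).
  by rewrite /k /mxindex; case: ex_minnP => j /eqP.
have [D0 defD0] : exists D, B ^+ k = D * B ^+ k.+1.
  apply/submxP; have sub : (B ^+ k.+1 <= B ^+ k)%MS.
    by rewrite exprS -mulmxE submxMl.
  by have [_ /esym] := mxrank_leqif_sup sub; rewrite rk eqxx.
have [E0 defE0] : exists E, B ^+ k = B ^+ k.+1 * E.
  have sub : ((B ^+ k.+1)^T <= (B ^+ k)^T)%MS.
    by rewrite exprSr -mulmxE trmx_mul submxMl.
  have [_ /esym] := mxrank_leqif_sup sub; rewrite !mxrank_tr rk eqxx.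
  by move=> /submxP[E /(congr1 trmx)]; rewrite trmx_mul !trmxK; exists E^T.
have [D defD] : exists D, B ^+ k = D * B ^+ (k.+1 + k).
  suff ex j : exists D, B ^+ k = D * B ^+ (j + k) by exact: ex.
  elim: j => [|j [D defD]]; first by exists 1; rewrite mul1r.
  exists (D * D0); rewrite {1}defD addnC exprD {1}defD0 -!mulrA -exprD.
  by congr (_ * (_ * _ ^+ _)); rewrite addSn addnC.
have [E defE] : exists E, B ^+ k = B ^+ (k.+1 + k) * E.
  suff ex j : exists E, B ^+ k = B ^+ (j + k) * E by exact: ex.
  elim: j => [|j [E defE]]; first by exists 1; rewrite mulr1.
  exists (E0 * E); rewrite {1}defE exprD {1}defE0 !mulrA -exprD.
  by congr (_ ^+ _ * _ * _); rewrite addnS.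
set M := B ^+ (k.+1 + k) in defD defE.
have BkS : B ^+ k.+1 * B ^+ k = M by rewrite -exprD.
have [G MGM] : {G : 'M[F]_n | M * G * M = M}.
  by exists (pinvmx M); exact: mulmx_pinvmxK.
have BM : B * M = M * B by rewrite -exprSr -exprS.
have BBk : B * B ^+ k = B ^+ k * B by rewrite -exprSr -exprS.
pose X := B ^+ k * G * B ^+ k.
have BX : B * X = B ^+ k.+1 * E.
  by rewrite /X {1}defD {1}defE !mulrA -(mulrA _ M G) -(mulrA _ (M * G) M) MGM
             -(mulrA _ D M) -defD -exprS.
have XB : X * B = D * B ^+ k.+1.
  by rewrite /X {1}defD {1}defE -!mulrA (mulrA M G) (mulrA (M * G) M) MGM
             (mulrA M E) -defE -exprSr.
have comm : B * X = X * B.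
  rewrite BX XB exprS BBk {1}defD -!mulrA (mulrA M B) -BM.
  by rewrite -mulrA -defE BBk.
have DkM : D * B ^+ k.+1 * B ^+ k = B ^+ k by rewrite -mulrA BkS -defD.
exists X; rewrite !mulmxE; apply/and3P; split; apply/eqP.
- by rewrite comm.
- by rewrite XB /X !mulrA DkM.
- by rewrite exprS mulrA XB DkM.
Qed.

(* The Drazin inverse, with k = ind(B): the unique X with B X = X B, X B X = X
   and X B^(k+1) = B^k, by drazinP and drazin_uniq. *)
Definition drazin B : 'M[F]_n := xchoose (is_drazin_ex B).

Lemma drazinP B : is_drazin B (drazin B).
Proof. exact: xchooseP. Qed.

Lemma is_drazin_inj B X Y : is_drazin B X -> is_drazin B Y -> X = Y.
Proof.
rewrite /is_drazin; set k := mxindex B.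
move=> /and3P[/eqP BX /eqP XBX /eqP Xk] /and3P[/eqP BY /eqP YBY /eqP Yk].
rewrite !mulmxE in BX XBX Xk BY YBY Yk.
have eE Z : B * Z = Z * B -> Z * B * Z = Z ->
    Z * B = Z ^+ k.+1 * B ^+ k.+1 /\ Z * B = B ^+ k.+1 * Z ^+ k.+1.
  move=> BZ ZBZ; suff ZB : Z * B = (Z * B) ^+ k.+1.
    have cBZ : GRing.comm Z B by [].
    by rewrite ZB exprMn_comm //; split=> //; apply: commrX; apply/commr_sym/commrX.
  elim: k {Xk Yk} => [|j IHj]; first by rewrite expr1.
  by rewrite exprS -IHj mulrA ZBZ.
have kE Z : B * Z = Z * B -> Z * B ^+ k.+1 = B ^+ k ->
    Z * B * B ^+ k.+1 = B ^+ k.+1 /\ B ^+ k.+1 * (Z * B) = B ^+ k.+1.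
  move=> BZ Zk; have ZBk : Z * B * B ^+ k.+1 = B ^+ k.+1.
    by rewrite -BZ -mulrA Zk -exprS.
  split=> //; rewrite -[RHS]ZBk; apply/esym; have cBZ : GRing.comm B Z by [].
  by apply: commr_sym; apply: commrM; apply/commr_sym/commrX.
have [eX1 eX2] := eE X BX XBX; have [eY1 eY2] := eE Y BY YBY.
have [kX1 kX2] := kE X BX Xk; have [kY1 kY2] := kE Y BY Yk.
have XY : X * B = Y * B.
  have <- : (Y * B) * (X * B) = X * B by rewrite eX2 mulrA kY1.
  by rewrite {1}eY1 -mulrA kX2.
by rewrite -XBX XY -mulrA BX XY -BY mulrA YBY.
Qed.

Lemma drazin_uniq B X : is_drazin B X -> drazin B = X.
Proof. exact/is_drazin_inj/drazinP. Qed.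

End Drazin.

(* The DMP inverse B^{D,+} and the MPD inverse B^{+,D}. *)
Definition dmpinv (C : numClosedFieldType) n (B : 'M[C]_n) : 'M[C]_n :=
  drazin B *m B *m mpinv B.

Definition mpdinv (C : numClosedFieldType) n (B : 'M[C]_n) : 'M[C]_n :=
  mpinv B *m B *m drazin B.

(* Main.v *)
Require Import Defs.
From mathcomp Require Import all_boot all_order all_algebra.
From mathcomp Require Import complex reals.
From mathcomp Require Import spectral.

(** Writing [H] for the conjugate transpose, it commutes with both inverses:
    [(B^H)^D = (B^D)^H] and [(B^H)^† = (B^†)^H].  When [A^† = A^H], the
    right-hand side of each of the three equations is therefore the conjugate
    transpose of the matrix whose Moore-Penrose inverse stands in the equation. *)

Import GRing.Theory.

Local Open Scope ring_scope.
Local Open Scope complex_scope.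
Local Open Scope sesquilinear_scope.

Lemma trmxC_exp (C : numClosedFieldType) (n k : nat) (B : 'M[C]_n) :
  (B ^+ k) ^t* = (B ^t*) ^+ k.
Proof.
elim: k => [|k IHk]; first by rewrite !expr0 trmx1 map_mx1.
by rewrite exprS exprSr -!mulmxE trmxC_mul IHk.
Qed.

Lemma mxrank_trmxC (C : numClosedFieldType) (m n : nat) (B : 'M[C]_(m, n)) :
  \rank (B ^t*) = \rank B.
Proof. by rewrite mxrank_map mxrank_tr. Qed.

(** Conjugate transposition preserves rank and commutes with powers, so both indices minimise the
    same predicate. *)
Lemma mxindex_trmxC (C : numClosedFieldType) (n : nat) (B : 'M[C]_n) :
  mxindex (B ^t*) = mxindex B.
Proof.
by apply: eq_ex_minn => k; rewrite -!trmxC_exp !mxrank_trmxC.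
Qed.

Lemma drazin_trmxC (C : numClosedFieldType) (n : nat) (B : 'M[C]_n) :
  drazin (B ^t*) = (drazin B) ^t*.
Proof.
apply: drazin_uniq; have /and3P[/eqP BX /eqP XBX /eqP Xk] := drazinP B.
rewrite /is_drazin mxindex_trmxC -!trmxC_exp -!trmxC_mul mulmxA XBX BX eqxx /=.
(* Transposition reverses products, so the third Drazin equation is needed with the power of [B] on
   the left of [drazin B]. *)
have XBk j : drazin B *m B ^+ j = B ^+ j *m drazin B.
  by rewrite !mulmxE; apply: commrX; rewrite /GRing.comm -!mulmxE BX.
by rewrite eqxx -XBk Xk eqxx.
Qed.

(** The Penrose equations are stable under conjugate transposition, which exchanges the two
    Hermitian conditions. *)
Lemma mpinv_trmxC (C : numClosedFieldType) (m n : nat) (B : 'M[C]_(m, n)) :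
  mpinv (B ^t*) = (mpinv B) ^t*.
Proof.
apply: mpinv_uniq.
have /and4P[/eqP BXB /eqP XBX /eqP BXH /eqP XBH] := mpinvP B.
by rewrite /is_mpinv -!trmxC_mul !mulmxA BXB XBX !BXH !XBH !eqxx.
Qed.

Lemma mpdinv_trmxC (C : numClosedFieldType) (n : nat) (B : 'M[C]_n) :
  mpdinv (B ^t*) = (dmpinv B) ^t*.
Proof.
by rewrite /mpdinv /dmpinv drazin_trmxC mpinv_trmxC !trmxC_mul !mulmxA.
Qed.

Lemma dmpinv_trmxC (C : numClosedFieldType) (n : nat) (B : 'M[C]_n) :
  dmpinv (B ^t*) = (mpdinv B) ^t*.
Proof. by rewrite -[B in RHS]trmxCK mpdinv_trmxC trmxCK. Qed.

Theorem theorem4p4 (R : realType) (n : nat) (A : 'M[R[i]]_n)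
    (A_pi : partial_isometry A) :
  (partial_isometry (drazin A) <-> drazin (mpinv A) = mpinv (drazin A)) /\
  (partial_isometry (drazin A) ->
     (partial_isometry (dmpinv A) <-> mpinv (dmpinv A) = mpdinv (mpinv A)) /\
     (partial_isometry (mpdinv A) <-> mpinv (mpdinv A) = dmpinv (mpinv A))).
Proof.
rewrite A_pi drazin_trmxC mpdinv_trmxC dmpinv_trmxC.
(* Each equation is now the definition of [partial_isometry], with sides swapped in (i). *)
by split; [split=> /esym | split].
Qed.
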